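(* Let $(X,d)$ be a metric space, let $T:X\rightarrow CB(X)$ be a multivalued $F_{C}$-contraction with $x_{0}\in X$, and let $$r=\inf \left\{ H(Tx,\{x\}): x\in X,\ H(Tx,\{x\})>0\right\}.$$ Then the circle $C_{x_{0},r}$ is a fixed circle of $T$. Also, every circle $C_{x_{0},\rho}$ with $\rho<r$ is a fixed circle of $T$.
   Context: For a metric space $(X,d)$, $CB(X)$ is the family of all nonempty, closed and bounded subsets of $X$. For $x\in X$ and $B\in CB(X)$, $D(x,B)=\inf\{d(x,y):y\in B\}$, and for $A,B\in CB(X)$, $H(A,B)=\max\{\sup_{x\in A}D(x,B),\sup_{y\in B}D(y,A)\}$ is the Hausdorff metric induced by $d$. The circle is $C_{x_{0},r}=\{x\in X:d(x,x_{0})=r\}$. A circle $C_{x_{0},r}$ is a fixed circle of $T:X\to CB(X)$ if $x\in Tx$ for each $x\in C_{x_{0},r}$. $\mathcal{F}$ is the family of all functions $F:(0,\infty)\to\mathbb{R}$ such that: (F1) $F$ is strictly increasing; (F2) for each sequence $\{\alpha_n\}$ in $(0,\infty)$, $\lim_{n\to\infty}\alpha_n=0$ if and only if $\lim_{n\to\infty}F(\alpha_n)=-\infty$; (F3) there exists $k\in(0,1)$ with $\lim_{\alpha\to0^+}\alpha^kF(\alpha)=0$. $T:X\to CB(X)$ is a multivalued $F_{C}$-contraction with $x_0\in X$ if there exist $F\in\mathcal{F}$ and $\tau>0$ such that for all $x\in X$: $H(Tx,\{x\})>0$ implies $\tau+F(H(Tx,\{x\}))\leq F(d(x,x_{0}))$.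 Since $F$ is defined only on $(0,\infty)$, the inequality is understood to include the requirement that its right-hand side is defined, i.e. $d(x,x_0)>0$. *)

(* Defs.v *)
From mathcomp Require Import all_boot all_order all_algebra.
From mathcomp Require Import all_classical all_reals all_analysis.
Set Implicit Arguments.
Unset Strict Implicit.
Unset Printing Implicit Defensive.
Import Order.TTheory GRing.Theory Num.Theory.
Import numFieldNormedType.Exports.
Local Open Scope classical_set_scope.
Local Open Scope ring_scope.

Definition metric_bounded (R : realType) (X : metricType R) (A : set X) : Prop :=
  exists M : R, forall x y : X, A x -> A y -> mdist x y <= M.

Definition CB (R : realType) (X : metricType R) : set (set X) :=
  [set A : set X | [/\ A !=set0, closed A & metric_bounded A]].

Definition point_dist (R : realType) (X : metricType R) (x : X) (B : set X) : R :=
  inf [set mdist x y | y in B].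

(* Real-valued sup and inf: junk-free when A and B belong to CB X, the only
   case in which it is used. *)
Definition hausdorff_dist (R : realType) (X : metricType R) (A B : set X) : R :=
  Num.max (sup [set point_dist x B | x in A]) (sup [set point_dist y A | y in B]).

Definition circle (R : realType) (X : metricType R) (x0 : X) (r : \bar R) : set X :=
  [set x : X | (mdist x x0)%:E = r].

Definition fixed_circle (R : realType) (X : metricType R) (T : X -> set X)
    (x0 : X) (r : \bar R) : Prop :=
  forall x : X, circle x0 r x -> T x x.

(* F : (0, oo) -> R is a total function constrained only on the positive
   reals; its other values are never used. *)
Definition F_family (R : realType) : set (R -> R) :=
  [set F : R -> R |
   [/\ forall a b : R, 0 < a -> a < b -> F a < F b,
       forall u : nat -> R, (forall n, 0 < u n) ->
         (u n @[n --> \oo] --> (0 : R)) <-> (F (u n) @[n --> \oo] --> -oo%R) &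
       exists k : R, [/\ 0 < k, k < 1 &
         (a `^ k * F a) @[a --> (0 : R)^'+] --> (0 : R)]]].

(* The conjunct 0 < mdist x x0 says that F (mdist x x0) is defined. *)
Definition FC_contraction (R : realType) (X : metricType R) (T : X -> set X)
    (x0 : X) : Prop :=
  exists F : R -> R, exists tau : R,
    [/\ F_family F, 0 < tau &
        forall x : X, 0 < hausdorff_dist (T x) [set x] ->
          0 < mdist x x0 /\
          tau + F (hausdorff_dist (T x) [set x]) <= F (mdist x x0)].

(* Extended-real because the set is empty when T x = [set x] for every x: the
   radius is then +oo, the circle of that radius is empty, and every real rho
   lies below it. *)
Definition FC_radius (R : realType) (X : metricType R) (T : X -> set X) : \bar R :=
  ereal_inf [set (hausdorff_dist (T x) [set x])%:E |
             x in [set x : X | 0 < hausdorff_dist (T x) [set x]]].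

(* Main.v *)
(** A point [x] outside [T x] has [H(Tx,{x}) > 0], because [T x] contains some
    [y <> x]; hence [H(Tx,{x}) >= r].  If moreover [d(x,x0) <= r], then
    [F(d(x,x0)) <= F(H(Tx,{x}))] by monotonicity of [F], which contradicts the
    contraction inequality since [tau > 0]. *)
Require Import Defs.
From mathcomp Require Import all_boot all_order all_algebra.
From mathcomp Require Import all_classical all_reals all_analysis.
Import Order.TTheory GRing.Theory Num.Theory.
Local Open Scope classical_set_scope.
Local Open Scope ring_scope.

Lemma point_dist_set1 (R : realType) (X : metricType R) (x y : X) :
  point_dist y [set x] = mdist y x.
Proof. by rewrite /point_dist image_set1 inf1. Qed.

(** The first supremum in [H] dominates its term at [y]. Boundedness matters here: the real [sup] of
    a set unbounded above is the default 0. *)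
Lemma hausdorff_dist_set1_ge (R : realType) (X : metricType R) (A : set X)
    (x y : X) :
  metric_bounded A -> A y -> mdist y x <= hausdorff_dist A [set x].
Proof.
move=> [M AM] Ay; rewrite /hausdorff_dist le_max; apply/orP; left.
apply: ub_le_sup; last by exists y => //; exact: point_dist_set1.
(* Triangle inequality through [y], with [mdist z y <= M]. *)
exists (M + mdist y x) => _ [z Az <-]; rewrite point_dist_set1.
apply: le_trans (metric_triangle z y x) _.
by rewrite lerD2r AM.
Qed.

(** Stated on the whole closed ball, so that one argument covers the circle of radius [FC_radius T]
    and all smaller ones. *)
Lemma FC_contraction_fixed (R : realType) (X : metricType R) (T : X -> set X)
    (x0 x : X) :
  (forall z : X, CB (T z)) -> FC_contraction T x0 ->
  ((mdist x x0)%:E <= FC_radius T)%E -> T x x.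
Proof.
move=> hT [F [tau [[Fincr _ _] tau0 hF]]] dr.
have [//|nTxx] := pselect (T x x).
have [[y Ty] _ Tbounded] := hT x.
have H0 : 0 < hausdorff_dist (T x) [set x].
  apply: lt_le_trans (hausdorff_dist_set1_ge _ _ _ x _ Tbounded Ty).
  by rewrite mdist_gt0; apply/eqP => yx; apply: nTxx; rewrite -{2}yx.
have [d0 tauF] := hF x H0.
have dH : mdist x x0 <= hausdorff_dist (T x) [set x].
  by rewrite -lee_fin (le_trans dr)//; apply: ereal_inf_lbound; exists x.
have FdH : F (mdist x x0) <= F (hausdorff_dist (T x) [set x]).
  (* [F] is strictly increasing on positive reals only: equality is split off, and [d0] gives
     positivity. *)
  by move: dH; rewrite le_eqVlt => /predU1P[->//|/(Fincr _ _ d0)/ltW].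
by have := le_trans tauF FdH; rewrite gerDr leNgt tau0.
Qed.

Theorem theorem2p1 (R : realType) (X : metricType R) (T : X -> set X) (x0 : X)
    (hT : forall x : X, CB (T x)) (hFC : FC_contraction T x0) :
  fixed_circle T x0 (FC_radius T) /\
  (forall rho : R, (rho%:E < FC_radius T)%E -> fixed_circle T x0 rho%:E).
Proof.
split=> [x dx|rho rho_lt x dx]; apply: (FC_contraction_fixed _ _ _ _ _ hT hFC).
  by rewrite dx.
by rewrite dx ltW.
Qed.
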